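(* Let $m<n$ and $1\le k<n$ be positive integers, let $A\in\mathbb{R}^{m\times n}$, and let $x\in\mathbb{R}^n$ be a $k$-sparse vector with $y=Ax$. Let $s(k)=1$ if $k$ is odd and $s(k)=0$ if $k$ is even. Let $\gamma^*$ ($\approx 0.2274$) be the unique root of $5\gamma^3+5\gamma^2+3\gamma-1=0$ in $(0,1)$. Assume $\delta_{k+s(k)}<\gamma^*$, put $\eta:=\sqrt{\frac{1+\delta_k}{1-2\delta_k-\delta_{k+s(k)}}}$, and assume that the parameters $\alpha>0$, $\beta$ satisfy $$0\leq\beta<\frac{1+1/\eta}{1+\sqrt{5}\,\delta_{k+s(k)}}-1,\qquad \frac{1+2\beta-1/\eta}{1-\sqrt{5}\,\delta_{k+s(k)}}<\alpha<\frac{1+1/\eta}{1+\sqrt{5}\,\delta_{k+s(k)}}.$$ Let $b:=\eta\left(|1+\beta-\alpha|+\sqrt{5}\,\alpha\,\delta_{k+s(k)}\right)$ and $\theta:=\frac{b+\sqrt{b^2+4\eta\beta}}{2}$ (one has $\theta<1$). Then every sequence $\{x^p\}$ generated by HBOT or by HBOTP with input $(A,y,k)$ and $k$-sparse initial points $x^0,x^1$ satisfies, for all $p\ge1$, $$\|x-x^p\|_2\leq C_1\theta^{p-1},\qquad C_1=\|x-x^1\|_2+(\theta-b)\|x-x^0\|_2,$$ and thus $\{x^p\}$ converges to $x$.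
   Context: Notation. A vector is $k$-sparse if it has at most $k$ nonzero entries. $\mathrm{supp}(z)=\{i: z_i\ne 0\}$. $u\circ v$ is the entrywise (Hadamard) product; $\mathbf{e}$ is the all-ones vector. Restricted isometry constant (RIC). For $A\in\mathbb{R}^{m\times n}$ with $m<n$, $\delta_t$ is the smallest number $\delta\ge 0$ such that $(1-\delta)\|u\|_2^2\le\|Au\|_2^2\le(1+\delta)\|u\|_2^2$ for all $t$-sparse $u\in\mathbb{R}^n$. Algorithms HBOT and HBOTP. Input: $(A,y,k)$, initial points $x^0,x^1\in\mathbb{R}^n$, parameters $\alpha>0$, $\beta\ge 0$. For $p=1,2,\dots$: (S1) $u^p=x^p-\alpha A^T(Ax^p-y)+\beta(x^p-x^{p-1})$. (S2) $w^*$ is a minimizer of $\|y-A(u^p\circ w)\|_2^2$ over all $w\in\{0,1\}^n$ with $\mathbf{e}^Tw=k$. (S3) For HBOT: $x^{p+1}=u^p\circ w^*$. For HBOTP: let $S^{p+1}=\mathrm{supp}(u^p\circ w^* )$ and let $x^{p+1}$ be a minimizer of $\|y-Az\|_2^2$ over all $z\in\mathbb{R}^n$ with $\mathrm{supp}(z)\subseteq S^{p+1}$. *)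

(* Defs.v *)
From HB Require Import structures.
From mathcomp Require Import all_boot all_order all_algebra.
From mathcomp Require Import all_classical all_reals all_analysis.

Set Implicit Arguments.
Unset Strict Implicit.
Unset Printing Implicit Defensive.

Import Order.TTheory GRing.Theory Num.Theory.
Import numFieldNormedType.Exports.

Local Open Scope classical_set_scope.
Local Open Scope ring_scope.

Section Vectors.
Variable R : realType.

(* The library norm on matrices is the sup norm, hence this definition. *)
Definition l2norm (n : nat) (v : 'cV[R]_n) : R :=
  Num.sqrt (\sum_(i < n) v i 0 ^+ 2).

Definition supp (n : nat) (v : 'cV[R]_n) : {set 'I_n} := [set i | v i 0 != 0].

Definition sparse (n k : nat) (v : 'cV[R]_n) : Prop := (#|supp v| <= k)%N.

Definition hadamard (n : nat) (u v : 'cV[R]_n) : 'cV[R]_n :=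
  \col_i (u i 0 * v i 0).

Definition restricted_isometry (m n t : nat) (A : 'M[R]_(m, n)) (d : R) : Prop :=
  forall u : 'cV[R]_n, sparse t u ->
    (1 - d) * l2norm u ^+ 2 <= l2norm (A *m u) ^+ 2 <= (1 + d) * l2norm u ^+ 2.

(* The infimum is attained, see [ric_least]. *)
Definition ric (m n : nat) (A : 'M[R]_(m, n)) (t : nat) : R :=
  inf [set d : R | 0 <= d /\ restricted_isometry t A d].

Definition is_minimizer (T : Type) (f : T -> R) (C : set T) (z : T) : Prop :=
  C z /\ forall z', C z' -> f z <= f z'.

End Vectors.

Section Algorithms.
Variables (R : realType) (m n : nat).
Variables (A : 'M[R]_(m, n)) (y : 'cV[R]_m) (k : nat) (alpha beta : R).

Definition residual (z : 'cV[R]_n) : R := l2norm (y - A *m z) ^+ 2.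

Definition heavy_ball (xprev xcur : 'cV[R]_n) : 'cV[R]_n :=
  xcur - alpha *: (A^T *m (A *m xcur - y)) + beta *: (xcur - xprev).

Definition selectors : set 'cV[R]_n :=
  [set w | (forall i, w i 0 = 0 \/ w i 0 = 1) /\ \sum_(i < n) w i 0 = k%:R].

Definition optimal_selector (u w : 'cV[R]_n) : Prop :=
  is_minimizer (fun w' => residual (hadamard u w')) selectors w.

(* The minimizers need not be unique, so the algorithms are relations: any
   choice of minimizers yields a generated sequence. *)
Definition HBOT_sequence (xs : nat -> 'cV[R]_n) : Prop :=
  forall p, (1 <= p)%N ->
    let u := heavy_ball (xs p.-1) (xs p) in
    exists2 w, optimal_selector u w & xs p.+1 = hadamard u w.

Definition HBOTP_sequence (xs : nat -> 'cV[R]_n) : Prop :=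
  forall p, (1 <= p)%N ->
    let u := heavy_ball (xs p.-1) (xs p) in
    exists2 w, optimal_selector u w &
      is_minimizer residual [set z | supp z \subset supp (hadamard u w)] (xs p.+1).

End Algorithms.

Definition gamma_root (R : realType) (g : R) : Prop :=
  0 < g < 1 /\ 5 * g ^+ 3 + 5 * g ^+ 2 + 3 * g - 1 = 0.

(* The default value 0 is never taken, see [gamma_star_unique]. *)
Definition gamma_star (R : realType) : R := xget 0 [set g | gamma_root g].

Section WellDefined.
Variable R : realType.

Lemma gamma_star_unique : unique (@gamma_root R) (gamma_star R).
Proof.
pose p : {poly R} := 5%:P * 'X^3 + 5%:P * 'X^2 + 3%:P * 'X - 1.
have pE g : p.[g] = 5 * g ^+ 3 + 5 * g ^+ 2 + 3 * g - 1 by rewrite !hornerE.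
have inc (a b : R) : 0 < a -> a < b -> p.[a] < p.[b].
  move=> a0 ab; have b0 := lt_trans a0 ab.
  have lX e : (0 < e)%N -> a ^+ e < b ^+ e.
    by move=> e0; rewrite ltrXn2r ?(ltW a0) ?(ltW b0) // -lt0n.
  rewrite !pE ltrD2r ltrD //; first by rewrite ltrD // ltr_pM2l ?lX.
  by rewrite ltr_pM2l.
have [g /andP[g0 g1] rg] : exists2 g : R, 0 <= g <= 1 & root p g.
  apply: poly_ivt; first exact: ler01.
  rewrite !pE !expr0n !expr1n /= !mulr0 !mulr1 !add0r lerN10 /=.
  by rewrite -addrA addr_ge0 // ?addr_ge0 // subr_ge0 ler1n.
have gR : gamma_root g.
  split; last by rewrite -pE; apply/eqP.
  rewrite !lt_neqAle g0 g1 !andbT.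
  apply/andP; split; apply/eqP => ge; move: rg.
    by rewrite rootE pE -ge !expr0n /= !mulr0 !add0r oppr_eq0 oner_eq0.
  rewrite rootE pE ge !expr1n !mulr1 => /eqP e0.
  have : (0 : R) < 5 + 5 + 3 - 1.
    by rewrite -addrA addr_gt0 // subr_gt0 ltr1n.
  by rewrite e0 ltxx.
have gsR : gamma_root (gamma_star R) by apply: (@xgetPex _ _ [set g | gamma_root g]); exists g.
split=> // h [/andP[h0 h1]]; rewrite -pE => ph.
case: gsR => /andP[s0 s1]; rewrite -pE => ps.
case: (ltgtP (gamma_star R) h) => // lt_sh.
  by have := inc _ _ s0 lt_sh; rewrite ps ph ltxx.
by have := inc _ _ h0 lt_sh; rewrite ps ph ltxx.
Qed.

Lemma l2norm_sqr n (v : 'cV[R]_n) : l2norm v ^+ 2 = \sum_(i < n) v i 0 ^+ 2.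
Proof. by rewrite sqr_sqrtr // sumr_ge0 // => i _; rewrite sqr_ge0. Qed.

Lemma ric_least (m n : nat) (A : 'M[R]_(m, n)) (t : nat) :
  [/\ 0 <= ric A t, restricted_isometry t A (ric A t) &
      forall d, 0 <= d -> restricted_isometry t A d -> ric A t <= d].
Proof.
set E := [set d : R | 0 <= d /\ restricted_isometry t A d].
have coordle p (v : 'cV[R]_p) i : `|v i 0| <= l2norm v.
  rewrite -sqrtr_sqr; apply: ler_wsqrtr; rewrite (bigD1 i) //= lerDl.
  by rewrite sumr_ge0 // => j _; rewrite sqr_ge0.
pose C := \sum_(i < m) (\sum_(j < n) `|A i j|) ^+ 2.
have C0 : 0 <= C by rewrite sumr_ge0 // => i _; rewrite sqr_ge0.
have bnd (u : 'cV[R]_n) : l2norm (A *m u) ^+ 2 <= C * l2norm u ^+ 2.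
  rewrite l2norm_sqr mulr_suml ler_sum // => i _.
  rewrite -exprMn -real_normK ?num_real //.
  rewrite lerXn2r ?nnegrE ?normr_ge0 ?mulr_ge0 ?sqrtr_ge0 ?sumr_ge0 //.
  rewrite mxE mulr_suml (le_trans (ler_norm_sum _ _ _)) // ler_sum // => j _.
  by rewrite normrM ler_wpM2l.
have Ene : E !=set0.
  exists (1 + C); split; first by rewrite addr_ge0.
  move=> u _; apply/andP; split.
    apply: (@le_trans _ _ 0); last by rewrite sqr_ge0.
    by rewrite mulr_le0_ge0 ?sqr_ge0 // opprD addNKr oppr_le0.
  apply: (le_trans (bnd u)); rewrite ler_wpM2r ?sqr_ge0 //.
  by rewrite addrA lerDr addr_ge0.
have E0 : has_lbound E by exists 0 => d [].
have r0 : 0 <= ric A t by apply: lb_le_inf => // d [].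
split=> //; last by move=> d d0 dR; apply: ge_inf.
move=> u su.
have [u0|un0] := eqVneq (l2norm u) 0.
  have Au0 : l2norm (A *m u) ^+ 2 = 0.
    apply/eqP; rewrite eq_le sqr_ge0 andbT.
    by rewrite (le_trans (bnd u)) // u0 expr0n mulr0.
  by rewrite Au0 u0 expr0n !mulr0 lexx.
have N0 : 0 < l2norm u ^+ 2 by rewrite exprn_gt0 // lt_def un0 sqrtr_ge0.
apply/andP; split.
  rewrite -ler_pdivlMr // lerBlDl -lerBlDr; apply: lb_le_inf => // d [_ /(_ u su)].
  by case/andP => + _; rewrite -ler_pdivlMr // lerBlDl -lerBlDr.
rewrite -ler_pdivrMr // -lerBlDl; apply: lb_le_inf => // d [_ /(_ u su)].
by case/andP => _; rewrite -ler_pdivrMr // -lerBlDl.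
Qed.

End WellDefined.

(* Main.v *)
(** With [B u v = <Au, Av> - <u, v>], restricted isometry of order [t] says that
    [|B u v| <= delta_t |u| |v|] whenever [u] and [v] have joint support of size
    at most [t]. Halving two [k]-sparse vectors gives
    [|B u v| <= (delta_k + delta_(k+s)) |u| |v|]. Hence [1 - 2 delta_k -
    delta_(k+s)] is a lower isometry constant on [2k]-sparse vectors. Moreover,
    for [g] supported on a [k]-set [S] containing the support of [x] and
    [h = x - x^p], splitting [h] along [S] bounds [B g h] by
    [delta |g| (|h_S| + 2 |h_{S^c}|) <= sqrt 5 delta |g| |h|].
    Comparing the optimal selector with the indicator of [S] then yields
    [E_(p+1) <= b E_p + eta beta E_(p-1)] for the errors [E_p = |x - x^p|], and
    [theta] is the nonnegative root of [t^2 = b t + eta beta], so that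
    [E_(p+1) + (theta - b) E_p] contracts by the factor [theta]. *)

Require Import Defs.
From mathcomp Require Import all_boot all_order all_algebra.
From mathcomp Require Import all_classical all_reals all_analysis.
From mathcomp Require Import lra.

Set Implicit Arguments.
Unset Strict Implicit.
Unset Printing Implicit Defensive.

Import Order.TTheory GRing.Theory Num.Theory.
Import numFieldNormedType.Exports.

Local Open Scope classical_set_scope.
Local Open Scope ring_scope.

(** Serves to halve a support and to enlarge [supp x] to exactly [k] indices. *)
Lemma subset_interpolation (T : finType) (k : nat) (S U : {set T}) :
  S \subset U -> (#|S| <= k <= #|U|)%N ->
  exists V : {set T}, [/\ S \subset V, V \subset U & #|V| = k].
Proof.
move=> SU /andP[+ kU]; move/subnK; move: (k - #|S|)%N => d.
elim: d S SU => [|d IH] S SU dk; first by exists S.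
have /subsetPn[a aU aS] : ~~ (U \subset S).
  apply/negP => /subset_leq_card US.
  by move: (leq_trans kU US); rewrite -dk addSn ltnNge leq_addl.
have [||V [SV VU Vk]] := IH (a |: S)%SET.
- by rewrite finset.subUset finset.sub1set aU.
- by rewrite cardsU1 aS addnA addn1.
by exists V; split=> //; apply: fintype.subset_trans SV; apply: finset.subsetUr.
Qed.


(** * Two-term linear recurrences and their dominant root *)

Section DominantRoot.
Variables (R : realType) (b c : R).
Hypotheses (b_ge0 : 0 <= b) (c_ge0 : 0 <= c).
Let theta := (b + Num.sqrt (b ^+ 2 + 4 * c)) / 2.

Let sqrt_disc : Num.sqrt (b ^+ 2 + 4 * c) ^+ 2 = b ^+ 2 + 4 * c.
Proof. by rewrite sqr_sqrtr // addr_ge0 ?sqr_ge0 ?mulr_ge0. Qed.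

Let b_le_sqrt : b <= Num.sqrt (b ^+ 2 + 4 * c).
Proof.
by rewrite -[leLHS](ger0_norm b_ge0) -sqrtr_sqr ler_wsqrtr // lerDl mulr_ge0.
Qed.

Lemma dominant_root_mul : theta * (theta - b) = c.
Proof. rewrite /theta; move: sqrt_disc; nra. Qed.

Lemma dominant_root_ge : b <= theta.
Proof. rewrite /theta; move: b_le_sqrt; lra. Qed.

(** If [theta >= 1], then [theta * (theta - b) >= 1 - b > c], against [dominant_root_mul]. *)
Lemma dominant_root_lt1 : b + c < 1 -> theta < 1.
Proof.
move=> bc1; have := dominant_root_mul; have := dominant_root_ge; nra.
Qed.

Lemma dominant_root_recurrence (E : nat -> R) :
  (forall p, E p.+2 <= b * E p.+1 + c * E p) -> (forall p, 0 <= E p) ->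
  forall p, E p.+1 <= (E 1%N + (theta - b) * E 0%N) * theta ^+ p.
Proof.
move=> rec Epos p.
have t0 : 0 <= theta by apply: le_trans dominant_root_ge.
have tb : 0 <= theta - b by rewrite subr_ge0 dominant_root_ge.
(* The strengthened quantity is inductive: the recurrence bounds its next value by
   [theta * E p.+1 + c * E p], and [c = theta * (theta - b)] makes this [theta] times the current
   one. *)
suff : E p.+1 + (theta - b) * E p <= (E 1%N + (theta - b) * E 0%N) * theta ^+ p.
  by apply: le_trans; rewrite lerDl mulr_ge0.
elim: p => [|p IH]; first by rewrite expr0 mulr1.
rewrite exprSr mulrA; apply: le_trans (ler_wpM2r t0 IH).
have := rec p; rewrite -dominant_root_mul; lra.
Qed.

End DominantRoot.

(** Dropping the positive quadratic and cubic terms of the defining equation leaves this bound. It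
    keeps the denominator in [eta] positive and, with [sqrt5_lt3], gives [sqrt 5 * dks < 1]. *)
Lemma gamma_star_lt3 (R : realType) : 3 * gamma_star R < 1.
Proof.
have [[/andP[g0 _] ge] _] := @gamma_star_unique R; nra.
Qed.

Lemma sqrt5_sqr (R : realType) : Num.sqrt (5 : R) ^+ 2 = 5.
Proof. by rewrite sqr_sqrtr. Qed.

Lemma sqrt5_lt3 (R : realType) : Num.sqrt (5 : R) < 3.
Proof. have := sqrt5_sqr R; have := sqrtr_ge0 (5 : R); nra. Qed.

(** * Euclidean inner product, supports and restriction to index sets *)

Section InnerProduct.
Variables (R : realType) (n : nat).
Implicit Types (u v w : 'cV[R]_n) (S T : {set 'I_n}) (c : R).

Definition dotv u v : R := \sum_i u i 0 * v i 0.

Lemma dotvC u v : dotv u v = dotv v u.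
Proof. by apply: eq_bigr => i _; rewrite mulrC. Qed.

Lemma dotvDr u v w : dotv u (v + w) = dotv u v + dotv u w.
Proof. by rewrite -big_split; apply: eq_bigr => i _; rewrite mxE mulrDr. Qed.

Lemma dotvZr c u v : dotv u (c *: v) = c * dotv u v.
Proof. by rewrite mulr_sumr; apply: eq_bigr => i _; rewrite mxE mulrCA. Qed.

Lemma dotvBr u v w : dotv u (v - w) = dotv u v - dotv u w.
Proof. by rewrite -scaleN1r dotvDr dotvZr mulN1r. Qed.

Lemma dotvDl u v w : dotv (v + w) u = dotv v u + dotv w u.
Proof. by rewrite !(dotvC _ u) dotvDr. Qed.

Lemma dotvZl c u v : dotv (c *: v) u = c * dotv v u.
Proof. by rewrite !(dotvC _ u) dotvZr. Qed.

Lemma l2norm_ge0 u : 0 <= l2norm u.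
Proof. exact: sqrtr_ge0. Qed.

Lemma l2norm_dot u : l2norm u ^+ 2 = dotv u u.
Proof. by rewrite l2norm_sqr; apply: eq_bigr => i _; rewrite expr2. Qed.

Lemma l2normZ c u : l2norm (c *: u) = `|c| * l2norm u.
Proof.
apply/eqP; rewrite -(eqrXn2 (n := 2)) ?mulr_ge0 ?l2norm_ge0 //.
by rewrite exprMn real_normK ?num_real // !l2norm_dot dotvZl dotvZr mulrA expr2.
Qed.

Lemma l2normN u : l2norm (- u) = l2norm u.
Proof. by rewrite -scaleN1r l2normZ normrN1 mul1r. Qed.

Lemma l2norm_eq0 u : l2norm u = 0 -> u = 0.
Proof.
move=> u0; have : \sum_i u i 0 ^+ 2 = 0 by rewrite -l2norm_sqr u0 expr0n.
move/psumr_eq0P => H; apply/colP => i; rewrite mxE; apply/eqP.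
by rewrite -sqrf_eq0 H // => j _; rewrite sqr_ge0.
Qed.

Lemma coord_le_l2norm u i : `|u i 0| <= l2norm u.
Proof.
rewrite -sqrtr_sqr; apply: ler_wsqrtr; rewrite (bigD1 i) //= lerDl.
by rewrite sumr_ge0 // => j _; rewrite sqr_ge0.
Qed.

(* An additive bound that survives scaling the arguments independently becomes
   a product bound: take [s = |v|] and [t = |u|]. *)
Lemma bilinear_product_bound (F : 'cV[R]_n -> 'cV[R]_n -> R) c u v :
  (forall s t u' v', F (s *: u') (t *: v') = s * t * F u' v') ->
  (forall s t, 2 * F (s *: u) (t *: v) <=
     c * (l2norm (s *: u) ^+ 2 + l2norm (t *: v) ^+ 2)) ->
  F u v <= c * l2norm u * l2norm v.
Proof.
move=> FZ Fle.
have [u0|un0] := eqVneq (l2norm u) 0.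
  by rewrite u0 mulr0 mul0r (l2norm_eq0 u0) -(scale0r 0) -[v]scale1r FZ !mul0r.
have [v0|vn0] := eqVneq (l2norm v) 0.
  by rewrite v0 mulr0 (l2norm_eq0 v0) -(scale0r 0) -[u]scale1r FZ mulr0 mul0r.
have up : 0 < l2norm u by rewrite lt_def un0 l2norm_ge0.
have vp : 0 < l2norm v by rewrite lt_def vn0 l2norm_ge0.
have := Fle (l2norm v) (l2norm u); rewrite FZ !l2normZ !ger0_norm ?l2norm_ge0 //.
set a := l2norm u in up *; set b := l2norm v in vp *.
have ab : 0 < b * a by rewrite mulr_gt0.
move=> H; rewrite -(ler_pM2l ab); move: H; lra.
Qed.

Lemma cauchy_schwarz u v : dotv u v <= l2norm u * l2norm v.
Proof.
rewrite -[leRHS]mul1r mulrA; apply: bilinear_product_bound => [s t u' v'|s t].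
  by rewrite dotvZl dotvZr mulrA.
(* Expanding this square gives the additive bound with [c = 1]. *)
have := sqr_ge0 (l2norm (s *: u - t *: v)).
rewrite !l2norm_dot dotvBr !(dotvC (_ - _)) !dotvBr (dotvC (t *: v) (s *: u)).
lra.
Qed.

Lemma supp_sparse k S u : supp u \subset S -> (#|S| <= k)%N -> sparse k u.
Proof. by move=> /subset_leq_card uS; apply: leq_trans. Qed.

Lemma supp_subP S u :
  reflect (forall i, i \notin S -> u i 0 = 0) (supp u \subset S).
Proof.
apply: (iffP fintype.subsetP) => H i.
  by apply: contraNeq => ui; apply: H; rewrite inE.
by rewrite inE; apply: contraR => /H ->.
Qed.

Lemma suppZ c u : supp (c *: u) \subset supp u.
Proof.
by apply/supp_subP => i; rewrite inE negbK mxE => /eqP ->; rewrite mulr0.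
Qed.

Lemma sparseZ k c u : sparse k u -> sparse k (c *: u).
Proof. exact: supp_sparse (suppZ c u). Qed.

Lemma suppD u v : supp (u + v) \subset (supp u :|: supp v)%SET.
Proof.
apply/supp_subP => i; rewrite !inE negb_or !negbK mxE.
by move=> /andP[/eqP -> /eqP ->]; rewrite addr0.
Qed.

Lemma sparseD p q u v : sparse p u -> sparse q v -> sparse (p + q) (u + v).
Proof.
move=> up vq; apply: supp_sparse (suppD u v) _.
by apply: leq_trans (leq_card_setU _ _) _; apply: leq_add.
Qed.

Lemma sparseB p q u v : sparse p u -> sparse q v -> sparse (p + q) (u - v).
Proof.
by move=> up vq; apply: sparseD => //; rewrite -scaleN1r; apply: sparseZ.
Qed.

Definition restrict S u : 'cV[R]_n := \col_i (if i \in S then u i 0 else 0).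

Lemma supp_restrict S u : supp (restrict S u) \subset S.
Proof. by apply/supp_subP => i iS; rewrite mxE (negPf iS). Qed.

Lemma restrict_split S u : u = restrict S u + restrict (~: S)%SET u.
Proof.
apply/colP => i; rewrite !mxE !inE.
by case: (i \in S); rewrite ?addr0 ?add0r.
Qed.

Lemma dotv_restrict S u v :
  dotv (restrict S u) v = dotv (restrict S u) (restrict S v).
Proof.
by apply: eq_bigr => i _; rewrite !mxE; case: ifP => // _; rewrite !mul0r.
Qed.

Lemma l2norm_restrict_split S u :
  l2norm u ^+ 2 = l2norm (restrict S u) ^+ 2 + l2norm (restrict (~: S)%SET u) ^+ 2.
Proof.
rewrite !l2norm_sqr -big_split; apply: eq_bigr => i _; rewrite !mxE !inE /=.
by case: (i \in S); rewrite ?expr0n ?addr0 ?add0r.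
Qed.

Lemma sparse_split p q u : sparse (p + q) u -> exists v w,
  [/\ sparse p v, sparse q w, u = v + w &
      l2norm u ^+ 2 = l2norm v ^+ 2 + l2norm w ^+ 2].
Proof.
move=> upq.
(* [S] is the whole support if that has at most [p] elements, and otherwise any [p] of its elements,
   leaving at most [q]. *)
have [S [Su Sp]] : exists S : {set 'I_n}, S \subset supp u /\
    (#|S| <= p)%N /\ (#|supp u :\: S|%SET <= q)%N.
  have [up|/ltnW pu] := leqP #|supp u| p.
    by exists (supp u); rewrite finset.setDv cards0.
  have [|S [_ Su Sp]] := subset_interpolation (k := p) (finset.sub0set (supp u)).
    by rewrite cards0.
  by exists S; rewrite cardsDS // Sp leqnn leq_subLR.
exists (restrict S u), (restrict (~: S)%SET u); split.
- by apply: supp_sparse (supp_restrict _ _) _; case: Sp.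
- apply: supp_sparse Sp.2; apply/supp_subP => i.
  rewrite !inE mxE inE; case: (i \in S) => //=.
  by rewrite negbK => /eqP.
- exact: restrict_split.
- exact: l2norm_restrict_split.
Qed.

End InnerProduct.

(** * Consequences of restricted isometry for the Gram matrix *)

Section RestrictedIsometry.
Variables (R : realType) (m n : nat) (A : 'M[R]_(m, n)).
Implicit Types (u v w g h : 'cV[R]_n) (S : {set 'I_n}).

Lemma dotv_trmx u (v : 'cV[R]_m) : dotv u (A^T *m v) = dotv (A *m u) v.
Proof.
rewrite /dotv; under eq_bigr do rewrite mxE mulr_sumr.
rewrite exchange_big; apply: eq_bigr => j _.
rewrite mxE mulr_suml; apply: eq_bigr => i _.
by rewrite mxE mulrCA mulrA.
Qed.

(** The bilinear form of [A^T A - I], written [B] in the overview. *)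
Definition gram_defect u v : R := dotv (A *m u) (A *m v) - dotv u v.

Lemma gram_defectZ (s t : R) u v :
  gram_defect (s *: u) (t *: v) = s * t * gram_defect u v.
Proof.
by rewrite /gram_defect -!scalemxAr !dotvZl !dotvZr !mulrA -mulrBr.
Qed.

Lemma gram_defectNr u v : gram_defect u (- v) = - gram_defect u v.
Proof. by rewrite -scaleN1r -[u in LHS]scale1r gram_defectZ mul1r mulN1r. Qed.

Lemma gram_defectC u v : gram_defect u v = gram_defect v u.
Proof. by rewrite /gram_defect dotvC (dotvC u). Qed.

Lemma gram_defectDr u v w :
  gram_defect u (v + w) = gram_defect u v + gram_defect u w.
Proof. by rewrite /gram_defect mulmxDr !dotvDr; lra. Qed.

Lemma gram_defectDl u v w :
  gram_defect (v + w) u = gram_defect v u + gram_defect w u.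
Proof. by rewrite !(gram_defectC _ u) gram_defectDr. Qed.

Lemma gram_defect_diag u :
  gram_defect u u = l2norm (A *m u) ^+ 2 - l2norm u ^+ 2.
Proof. by rewrite !l2norm_dot. Qed.

(** Polarization: [4 B u v = B (u+v) (u+v) - B (u-v) (u-v)] is at most [d (|u+v|^2 + |u-v|^2) = 2 d
    (|u|^2 + |v|^2)], which [bilinear_product_bound] turns into a product. A one-sided bound is
    enough because [v] may be replaced by [- v]. *)
Lemma gram_defect_le t (d : R) u v S :
  restricted_isometry t A d ->
  supp u \subset S -> supp v \subset S -> (#|S| <= t)%N ->
  gram_defect u v <= d * l2norm u * l2norm v.
Proof.
move=> rip uS vS St.
apply: bilinear_product_bound => [s' t' u' v'|a b]; first exact: gram_defectZ.
set u1 := a *: u; set v1 := b *: v.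
have sp c : sparse t (u1 + c *: v1).
  apply: supp_sparse St; apply/supp_subP => i iS; rewrite !mxE.
  by rewrite (supp_subP _ _ uS i iS) (supp_subP _ _ vS i iS) !mulr0 addr0.
have /andP[_ +] := rip _ (sp 1); have /andP[+ _] := rip _ (sp (-1)).
have defD w : l2norm (A *m w) ^+ 2 = gram_defect w w + l2norm w ^+ 2.
  by rewrite gram_defect_diag subrK.
rewrite !defD scale1r scaleN1r !l2norm_dot !(gram_defectDl, gram_defectDr).
rewrite !gram_defectNr !(gram_defectC (- _)) !gram_defectNr (gram_defectC v1 u1).
rewrite !dotvBr !(dotvC (_ - _)) !dotvBr !dotvDr !dotvDl (dotvC v1 u1).
lra.
Qed.

Lemma gram_defect_sparse_le t p q (d : R) u v :
  restricted_isometry t A d -> sparse p u -> sparse q v -> (p + q <= t)%N ->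
  gram_defect u v <= d * l2norm u * l2norm v.
Proof.
move=> rip up vq pqt.
apply: (gram_defect_le (S := (supp u :|: supp v)%SET) rip).
- exact: finset.subsetUl.
- exact: finset.subsetUr.
apply: leq_trans pqt; apply: leq_trans (leq_card_setU _ _) _.
exact: leq_add.
Qed.

(** [d] and [e] stand for the constants of orders [k] and [k + s(k)]; [odd k], coerced to a number,
    is [s(k)]. *)
Variables (k : nat) (d e : R).
Hypotheses (d_ge0 : 0 <= d) (d_le_e : d <= e).
Hypotheses (rip_k : restricted_isometry k A d).
Hypotheses (rip_ks : restricted_isometry (k + odd k) A e).

(* Halving both vectors produces four pairs; only the pair of two larger halves
   may need order [k + 1], the other three have joint support at most [k]. *)
Lemma gram_defect_double_le u v : sparse k u -> sparse k v ->
  gram_defect u v <= (d + e) * l2norm u * l2norm v.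
Proof.
move=> uk vk.
apply: bilinear_product_bound => [s' t' u' v'|a b]; first exact: gram_defectZ.
have := sparseZ b vk; have := sparseZ a uk; move: (a *: u) (b *: v) => {uk vk}u
  {}v.
have kE : k = (k./2 + uphalf k)%N.
  by rewrite uphalf_half addnCA addnn odd_double_half.
have ksE : (uphalf k + uphalf k = k + odd k)%N.
  by rewrite addnn uphalf_half doubleD -addnn -addnA odd_double_half addnC.
rewrite {1 2}kE => /sparse_split[u1 [u2 [u1k u2k -> ->]]].
move=> /sparse_split[v1 [v2 [v1k v2k -> ->]]].
have kk : (k./2 + k./2 <= k)%N by rewrite addnn -[leqRHS]odd_double_half leq_addl.
have D11 := gram_defect_sparse_le rip_k u1k v1k kk.
have D12 : gram_defect u1 v2 <= d * l2norm u1 * l2norm v2.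
  by apply: (gram_defect_sparse_le rip_k u1k v2k); rewrite -kE.
have D21 : gram_defect u2 v1 <= d * l2norm u2 * l2norm v1.
  by apply: (gram_defect_sparse_le rip_k u2k v1k); rewrite addnC -kE.
have D22 : gram_defect u2 v2 <= e * l2norm u2 * l2norm v2.
  by apply: (gram_defect_sparse_le rip_ks u2k v2k); rewrite ksE.
rewrite !(gram_defectDl, gram_defectDr).
have amgm (c s t : R) : 0 <= c -> 2 * (c * s * t) <= c * (s ^+ 2 + t ^+ 2).
  move=> c0; have : 0 <= c * (s - t) ^+ 2 by rewrite mulr_ge0 ?sqr_ge0.
  lra.
have e_ge0 := le_trans d_ge0 d_le_e.
have := amgm _ (l2norm u1) (l2norm v1) d_ge0.
have := amgm _ (l2norm u1) (l2norm v2) d_ge0.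
have := amgm _ (l2norm u2) (l2norm v1) d_ge0.
have := amgm _ (l2norm u2) (l2norm v2) e_ge0.
(* The four products give weight [2 d] to the squares of [u1], [v1] and [d + e] to those of [u2],
   [v2]; this term raises the former to [d + e]. *)
have : 0 <= (e - d) * (l2norm u1 ^+ 2 + l2norm v1 ^+ 2).
  by rewrite mulr_ge0 ?subr_ge0 // addr_ge0 ?sqr_ge0.
lra.
Qed.

(** For orthogonal halves [v] and [w], [|Au|^2 = |Av|^2 + |Aw|^2 + 2 B v w]. The squares lose a
    factor [1 - d], and the cross term costs at most [2 (d + e) |v| |w| <= (d + e) |u|^2]. *)
Lemma restricted_isometry_double_lower u : sparse (k + k) u ->
  (1 - 2 * d - e) * l2norm u ^+ 2 <= l2norm (A *m u) ^+ 2.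
Proof.
move=> /sparse_split[v [w [vk wk uE uN]]].
have wNk : sparse k (- w) by rewrite -scaleN1r; apply: sparseZ.
have := gram_defect_double_le vk wNk; rewrite gram_defectNr l2normN.
have /andP[+ _] := rip_k vk; have /andP[+ _] := rip_k wk.
have vw : dotv v w = 0.
  by move: uN; rewrite uE !l2norm_dot dotvDr !dotvDl (dotvC w v); lra.
have -> : l2norm (A *m u) ^+ 2 = l2norm (A *m v) ^+ 2 + l2norm (A *m w) ^+ 2
    + 2 * gram_defect v w.
  rewrite uE /gram_defect vw subr0 mulmxDr !l2norm_dot dotvDr !dotvDl.
  by rewrite (dotvC (A *m w) (A *m v)); lra.
rewrite uN.
have : 0 <= (d + e) * (l2norm v - l2norm w) ^+ 2.
  by rewrite mulr_ge0 ?sqr_ge0 // addr_ge0 // (le_trans d_ge0).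
lra.
Qed.

Lemma gram_defect_sqrt5_le g h S :
  supp g \subset S -> (#|S| <= k)%N -> sparse k (restrict (~: S)%SET h) ->
  gram_defect g h <= Num.sqrt 5 * e * l2norm g * l2norm h.
Proof.
move=> gS Sk hk; have e_ge0 := le_trans d_ge0 d_le_e.
have D1 := gram_defect_le rip_k gS (supp_restrict S h) Sk.
have D2 := gram_defect_double_le (supp_sparse gS Sk) hk.
rewrite {1}(restrict_split S h) gram_defectDr.
set a := l2norm (restrict S h) in D1; set c := l2norm (restrict _ h) in D2.
have g0 := l2norm_ge0 g; have h0 := l2norm_ge0 h.
have a0 : 0 <= a by exact: l2norm_ge0.
have c0 : 0 <= c by exact: l2norm_ge0.
have s0 := sqrtr_ge0 (5 : R).
have hE : l2norm h ^+ 2 = a ^+ 2 + c ^+ 2 by apply: l2norm_restrict_split.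
(* Here [sqrt 5] is the norm of [(1, 2)]: this is Cauchy-Schwarz in the plane, with squared gap
   [(2 a - c)^2]. *)
have ac : a + 2 * c <= Num.sqrt 5 * l2norm h.
  rewrite -(@ler_pXn2r _ 2) ?nnegrE ?addr_ge0 ?mulr_ge0 // exprMn sqrt5_sqr hE.
  by have := sqr_ge0 (2 * a - c); lra.
have eg : 0 <= e * l2norm g by rewrite mulr_ge0.
have := ler_wpM2l eg ac.
(* Raises the weights [d] of [a] and [d + e] of [c] to [e] and [2 e]. *)
have : 0 <= (e - d) * (l2norm g * (a + c)).
  by rewrite mulr_ge0 ?subr_ge0 // mulr_ge0 // addr_ge0.
lra.
Qed.

(** * Error of one step of the algorithms *)

Lemma heavy_ball_restrict_error (alpha beta : R) x x0 x1 S :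
  0 <= alpha -> 0 <= beta ->
  supp x \subset S -> (#|S| <= k)%N -> sparse k x1 ->
  l2norm (restrict S (x - heavy_ball A (A *m x) alpha beta x0 x1)) <=
    (`|1 + beta - alpha| + Num.sqrt 5 * alpha * e) * l2norm (x - x1)
    + beta * l2norm (x - x0).
Proof.
move=> al be xS Sk x1k; set h := x - x1; set h0 := x - x0.
set r := x - _; set g := restrict S r.
have [-> | gn0] := eqVneq (l2norm g) 0.
  have e_ge0 := le_trans d_ge0 d_le_e.
  by rewrite addr_ge0 ?mulr_ge0 ?l2norm_ge0 // addr_ge0 // !mulr_ge0 // sqrtr_ge0.
have gp : 0 < l2norm g by rewrite lt_def gn0 l2norm_ge0.
(* As [g] is the restriction of [r], [|g|^2] equals the inner product of [g] and [r], which is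
   linear in the errors [h] and [h0]. *)
rewrite -(ler_pM2l gp) -expr2 l2norm_dot -dotv_restrict -/g.
have rE : r = (1 + beta) *: h - alpha *: (A^T *m (A *m h)) - beta *: h0.
  rewrite /r /heavy_ball /h /h0 !mulmxBr !scalerBr !scalerDl !scale1r.
  by apply/colP => i; rewrite !mxE; lra.
have gS : supp g \subset S by exact: supp_restrict.
(* Off [S] the vector [x] vanishes, so [- h] agrees with [x1] there. The sign is flipped because
   [gram_defect g h] enters with coefficient [- alpha]. *)
have hk : sparse k (restrict (~: S)%SET (- h)).
  apply: supp_sparse x1k; apply/supp_subP => i.
  rewrite !inE negbK !mxE inE => /eqP ->; rewrite subr0.
  by case: ifP => // /(supp_subP _ _ xS) ->; rewrite oppr0.
have D := gram_defect_sqrt5_le gS Sk hk.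
rewrite gram_defectNr l2normN in D.
clearbody g r h h0.
have gE : dotv g r =
    (1 + beta - alpha) * dotv g h - alpha * gram_defect g h - beta * dotv g h0.
  by rewrite rE !dotvBr !dotvZr dotv_trmx /gram_defect; lra.
have C1 := cauchy_schwarz g h.
have C1' := cauchy_schwarz g (- h).
have C0 := cauchy_schwarz g (- h0).
rewrite -scaleN1r dotvZr mulN1r scaleN1r l2normN in C1'.
rewrite -scaleN1r dotvZr mulN1r scaleN1r l2normN in C0.
have C : (1 + beta - alpha) * dotv g h <=
    `|1 + beta - alpha| * (l2norm g * l2norm h).
  apply: le_trans (ler_norm _) _; rewrite normrM ler_wpM2l //.
  by rewrite ler_norml lerNl C1' C1.
have := ler_wpM2l al D; have := ler_wpM2l be C0.
rewrite gE; lra.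
Qed.

Lemma sparse_hadamard_selector u w : selectors k w -> sparse k (hadamard u w).
Proof.
move=> [w01 wk]; apply: (supp_sparse (S := supp w)).
  apply/supp_subP => i; rewrite inE negbK mxE => /eqP ->.
  by rewrite mulr0.
rewrite -(ler_nat R) -wk -sum1_card natr_sum big_mkcond ler_sum // => i _.
by rewrite inE; case: (w01 i) => ->; rewrite ?eqxx ?oner_eq0.
Qed.

(** The indicator of [S] competes with [w]; it is feasible because [S] has exactly [k] elements.
    Since [x] vanishes off [S], its error is the restriction of [x - u] to [S]. *)
Lemma optimal_selector_residual x u w : sparse k x -> (k <= n)%N ->
  optimal_selector A (A *m x) k u w ->
  exists S : {set 'I_n}, [/\ supp x \subset S, #|S| = k &
    residual A (A *m x) (hadamard u w) <=
      (1 + d) * l2norm (restrict S (x - u)) ^+ 2].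
Proof.
move=> xk kn [_ wmin].
have [|S [xS _ Sk]] := subset_interpolation (k := k) (finset.subsetT (supp x)).
  by rewrite cardsT card_ord kn andbT.
exists S; split=> //.
pose w' : 'cV[R]_n := \col_i (i \in S)%:R.
have w'P : selectors k w'.
  split=> [i|]; first by rewrite mxE; case: (i \in S); [right|left].
  under eq_bigr do rewrite mxE; rewrite -Sk -sum1_card natr_sum [RHS]big_mkcond.
  by apply: eq_bigr => i _; case: ifP.
apply: le_trans (wmin _ w'P) _.
rewrite /residual -mulmxBr.
have -> : x - hadamard u w' = restrict S (x - u).
  apply/colP => i; rewrite !mxE; case: ifPn; first by rewrite mulr1.
  by move=> /(supp_subP _ _ xS) ->; rewrite mulr0 subr0.
have /rip_k/andP[_] // : sparse k (restrict S (x - u)).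
by apply: supp_sparse (supp_restrict _ _) _; rewrite Sk.
Qed.

(** Asking only that [x2] have no larger residual than [hadamard u w] covers HBOT and HBOTP at once.
    As [x - x2] is [2k]-sparse, [eta ^+ 2] is the ratio of the upper constant to the lower one. *)
Lemma thresholding_step_error (alpha beta : R) x x0 x1 x2 w :
  let u := heavy_ball A (A *m x) alpha beta x0 x1 in
  let eta := Num.sqrt ((1 + d) / (1 - 2 * d - e)) in
  0 <= alpha -> 0 <= beta -> 0 < 1 - 2 * d - e -> (k <= n)%N ->
  sparse k x -> sparse k x1 -> sparse k x2 ->
  optimal_selector A (A *m x) k u w ->
  residual A (A *m x) x2 <= residual A (A *m x) (hadamard u w) ->
  l2norm (x - x2) <=
    eta * (`|1 + beta - alpha| + Num.sqrt 5 * alpha * e) * l2norm (x - x1)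
    + eta * beta * l2norm (x - x0).
Proof.
move=> u eta al be den kn xk x1k x2k wopt res.
have [S [xS Sk uS]] := optimal_selector_residual xk kn wopt.
have Sk' : (#|S| <= k)%N by rewrite Sk.
have eta_ge0 : 0 <= eta by exact: sqrtr_ge0.
have err := heavy_ball_restrict_error x0 al be xS Sk' x1k.
rewrite -(mulrA eta) -(mulrA eta beta) -mulrDr; apply: le_trans (ler_wpM2l eta_ge0 err).
rewrite -(@ler_pXn2r _ 2) ?nnegrE ?mulr_ge0 ?l2norm_ge0 //.
rewrite exprMn [eta ^+ 2]sqr_sqrtr; last by rewrite divr_ge0 ?(ltW den) // addr_ge0.
rewrite mulrAC ler_pdivlMr // mulrC; apply: le_trans uS.
apply: le_trans res; rewrite /residual -mulmxBr.
exact: restricted_isometry_double_lower (sparseB xk x2k).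
Qed.

End RestrictedIsometry.

(** * Convergence of the generated sequences *)

Lemma cvg_l2norm_geometric (R : realType) (n : nat) (xs : nat -> 'cV[R]_n)
    (x : 'cV[R]_n) (C theta : R) :
  0 <= theta < 1 ->
  (forall p, l2norm (x - xs p.+1) <= C * theta ^+ p) -> xs @ \oo --> x.
Proof.
move=> /andP[t0 t1] bound.
have geo : (fun p => C * theta ^+ p) @ \oo --> (0 : R).
  by apply: cvg_geometric; rewrite ger0_norm.
rewrite -cvg_shiftS; apply/cvgrPdist_lt => eps eps0.
have /cvgrPdist_lt/(_ eps eps0) := geo; apply: filterS => p.
rewrite sub0r normrN => lt_eps.
(* The topology uses the sup norm, so each coordinate is bounded by [l2norm]. *)
rewrite [ltLHS]/Num.norm /= mx_normrE; apply/bigmax_ltP; split=> // -[i j] _ /=.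
rewrite (ord1 j); apply: le_lt_trans (coord_le_l2norm _ _) _.
apply: le_lt_trans (bound p) _; apply: le_lt_trans lt_eps.
exact: ler_norm.
Qed.

Lemma ric_mono (R : realType) (m n s t : nat) (A : 'M[R]_(m, n)) :
  (s <= t)%N -> ric A s <= ric A t.
Proof.
move=> st; have [_ _ least] := ric_least A s; have [t0 ript _] := ric_least A t.
by apply: least => // u us; apply: ript; apply: leq_trans st.
Qed.

Theorem corollary1 (R : realType) (m n k : nat)
    (m_gt0 : (0 < m)%N) (lt_mn : (m < n)%N) (k_gt0 : (1 <= k)%N) (lt_kn : (k < n)%N)
    (A : 'M[R]_(m, n)) (x : 'cV[R]_n) (y : 'cV[R]_m)
    (x_sparse : sparse k x) (yE : y = A *m x) (alpha beta : R) :
  let s := (if odd k then 1 else 0)%N in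
  let dk := ric A k in
  let dks := ric A (k + s) in
  let eta := Num.sqrt ((1 + dk) / (1 - 2 * dk - dks)) in
  let b := eta * (`|1 + beta - alpha| + Num.sqrt 5 * alpha * dks) in
  let theta := (b + Num.sqrt (b ^+ 2 + 4 * eta * beta)) / 2 in
  dks < gamma_star R ->
  0 < alpha ->
  0 <= beta < (1 + 1 / eta) / (1 + Num.sqrt 5 * dks) - 1 ->
  (1 + 2 * beta - 1 / eta) / (1 - Num.sqrt 5 * dks) < alpha
    < (1 + 1 / eta) / (1 + Num.sqrt 5 * dks) ->
  theta < 1 /\
  forall xs : nat -> 'cV[R]_n,
    sparse k (xs 0%N) -> sparse k (xs 1%N) ->
    HBOT_sequence A y k alpha beta xs \/ HBOTP_sequence A y k alpha beta xs ->
    let C1 := l2norm (x - xs 1%N) + (theta - b) * l2norm (x - xs 0%N) in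
    (forall p, (1 <= p)%N -> l2norm (x - xs p) <= C1 * theta ^+ p.-1) /\
    xs @ \oo --> x.
Proof.
move=> s dk dks eta b theta dks_lt alpha_gt0 /andP[beta_ge0 beta_lt] /andP[lo hi].
have [dk0 rip_k _] := ric_least A k; rewrite -/dk in dk0 rip_k.
have [dks0 rip_ks _] := ric_least A (k + s); rewrite -/dks in dks0 rip_ks.
have dk_dks : dk <= dks by apply: ric_mono; rewrite leq_addr.
have g3 := gamma_star_lt3 R.
have den : 0 < 1 - 2 * dk - dks by lra.
have eta_gt0 : 0 < eta.
  by rewrite sqrtr_gt0 divr_gt0 // (lt_le_trans ltr01) // lerDl.
have s5 := sqrt5_lt3 R; have s5_ge0 := sqrtr_ge0 (5 : R).
have q_ge0 : 0 <= Num.sqrt 5 * dks by rewrite mulr_ge0.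
have q_lt1 : Num.sqrt 5 * dks < 1.
  by apply: (le_lt_trans (ler_wpM2r dks0 (ltW s5))); lra.
have b_ge0 : 0 <= b.
  by rewrite mulr_ge0 ?(ltW eta_gt0) // addr_ge0 // !mulr_ge0 // ltW.
have c_ge0 : 0 <= eta * beta by rewrite mulr_ge0 // ltW.
have thetaE : theta = (b + Num.sqrt (b ^+ 2 + 4 * (eta * beta))) / 2.
  by rewrite /theta mulrA.
(* Divided by [eta], this reads [|1 + beta - alpha| + sqrt 5 * alpha * dks + beta < 1 / eta]. If
   [1 + beta - alpha] is nonnegative, it is the lower bound on [alpha]; otherwise [beta] cancels and
   it is the upper bound. *)
have bc1 : b + eta * beta < 1.
  rewrite ltr_pdivrMr ?subr_gt0 // in lo.
  have q1_gt0 : 0 < 1 + Num.sqrt 5 * dks by rewrite ltr_pwDl.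
  rewrite ltr_pdivlMr // in hi.
  rewrite /b -mulrDr mulrC -ltr_pdivlMr //.
  by case: (ger0P (1 + beta - alpha)) => _; lra.
have theta_lt1 : theta < 1 by rewrite thetaE; apply: dominant_root_lt1.
split=> // xs xs0 xs1 gen C1.
have theta_ge0 : 0 <= theta.
  by rewrite thetaE; apply: le_trans (dominant_root_ge b_ge0 c_ge0).
(* The common description of both algorithms: the residuals agree for HBOT, while for HBOTP
   [hadamard u w] is itself feasible in the least-squares problem. *)
have step p : (1 <= p)%N ->
    let u := heavy_ball A y alpha beta (xs p.-1) (xs p) in
    exists w, [/\ optimal_selector A y k u w, sparse k (xs p.+1) &
      residual A y (xs p.+1) <= residual A y (hadamard u w)].
  case: gen => gen p1 u; have [w wopt xsE] := gen p p1; exists w;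
    have hk : sparse k (hadamard u w)
      by apply: sparse_hadamard_selector; case: wopt.
    by rewrite xsE; split.
  case: xsE => sub res; split=> //; first exact: supp_sparse sub hk.
  by apply: res => /=.
have xsk p : sparse k (xs p).
  by case: p => [|[|p]] //; have [w []] := step p.+1 isT.
have rec p : l2norm (x - xs p.+2) <=
    b * l2norm (x - xs p.+1) + eta * beta * l2norm (x - xs p).
  have [w [wopt _ res]] := step p.+1 isT; rewrite yE in wopt res.
  exact: (thresholding_step_error dk0 dk_dks rip_k rip_ks (ltW alpha_gt0)
    beta_ge0 den (ltnW lt_kn) x_sparse (xsk _) (xsk _) wopt res).
have bound p : l2norm (x - xs p.+1) <= C1 * theta ^+ p.
  rewrite /C1 thetaE.
  exact: (dominant_root_recurrence b_ge0 c_ge0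
    (E := fun p => l2norm (x - xs p)) rec (fun _ => l2norm_ge0 _)).
split; first by case.
by apply: cvg_l2norm_geometric bound; rewrite theta_ge0.
Qed.
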